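(* Let $k\geq 3$ and $q\geq 0$ be integers. Then every $q$-tight $(k,0)$-stable graph has at most $(k-3)+2^{3(2q+3)^2}$ vertices.
   Context: All graphs are finite, simple and undirected. $\alpha(G)$ denotes the independence number of $G$, and $G-S$ denotes the subgraph of $G$ induced on $V(G)\setminus S$. For integers $k>\ell\geq 0$, a graph $G$ is $(k,\ell)$-stable if for every $S\subseteq V(G)$ with $|S|=k$ we have $\alpha(G-S)\geq \alpha(G)-\ell$. For an integer $q\geq 0$, a graph $G$ on $n$ vertices is $q$-tight $(k,\ell)$-stable if $G$ is $(k,\ell)$-stable and $\alpha(G)=\left\lfloor \frac{n-k+1}{2}\right\rfloor+\ell-q$. *)

(* Defs.v *)
From HB Require Import structures.
From mathcomp Require Import all_boot all_order all_algebra.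

Set Implicit Arguments.
Unset Strict Implicit.
Unset Printing Implicit Defensive.

Record sgraph := SGraph {
  vertex :> finType;
  adj : rel vertex;
  adj_sym : symmetric adj;
  adj_irrefl : irreflexive adj
}.

Section Graphs.
Implicit Types (G : sgraph) (k l q : nat).

Definition independent G (A : {set G}) : bool :=
  [forall x in A, forall y in A, ~~ adj x y].

Definition alpha G : nat := \max_(A : {set G} | independent A) #|A|.

Section Delete.
Variables (G : sgraph) (S : {set G}).

Definition del_vertex : finType := {x : G | x \notin S}.
Definition del_adj : rel del_vertex := fun u v => adj (val u) (val v).

Lemma del_adj_sym : symmetric del_adj.
Proof. by move=> u v; apply: adj_sym. Qed.

Lemma del_adj_irrefl : irreflexive del_adj.
Proof. by move=> u; apply: adj_irrefl. Qed.

Definition del : sgraph := SGraph del_adj_sym del_adj_irrefl.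

End Delete.

(* Truncated subtraction is harmless here, since alpha (del S) >= 0. *)
Definition stable k l G : Prop :=
  forall S : {set G}, #|S| = k -> alpha G - l <= alpha (del S).

(* The equation lives in int: #|G| - k + 1 may be negative, and (_ %/ 2)%Z is
   the floor of the half. *)
Definition tight_stable q k l G : Prop :=
  stable k l G /\
  ((alpha G)%:Z = ((#|G|%:Z - k%:Z + 1) %/ 2)%Z + l%:Z - q%:Z)%R.

End Graphs.

(* Main.v *)
(* Deleting k - 3 vertices reduces to k = 3, and deleting edges makes every edge
   critical; all degrees are then at least 3.  Put d = |G| - 2 alpha(G) and fix
   a maximum independent set A with complement B.  By Hall's theorem a generic
   matrix supported on the A-B edges has a kernel of dimension d.  Each edge uv
   inside B yields a kernel vector phi with phi(u) phi(v) <> 0 that vanishes at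
   an end of every other such edge, so B contains at most d(d+1)/2 edges; let C
   cover them.

   Maximum independent sets correspond to the tight sets S in B (independent,
   with |S| neighbours in A).  The tight sets with a given trace on C form a
   class, closed under union, and each class c has a matching mu_c of A into B
   that is compatible with all of them.  If b in B has all its neighbours in A,
   then each edge ab is mu_c-matched for some class c, in which b may be added
   to a tight set; so three edges at b give three classes.  Each class orders
   such vertices by inclusion of tight sets, and along an alternating path of
   mu_c and mu_c' the two orders are opposite.  Of three orders on two vertices
   two agree; hence b is determined by its three classes and by the ends of the
   three alternating paths through b (d choices each).  Counting gives the
   bound. *)
Require Import Defs.
From mathcomp Require Import all_boot all_order all_algebra.
From mathcomp Require Import fingroup perm zify.

Set Implicit Arguments.
Unset Strict Implicit.
Unset Printing Implicit Defensive.

(** * Hall's marriage theorem *)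

Section Hall.
Variable T : finType.
Implicit Types (e : rel T) (X Y Z : {set T}).

Definition nbrs e X : {set T} := [set y | [exists x in X, e x y]].

Lemma nbrsP e X y : reflect (exists2 x, x \in X & e x y) (y \in nbrs e X).
Proof. by rewrite inE; apply: exists_inP. Qed.

Lemma nbrsS e X Y : X \subset Y -> nbrs e X \subset nbrs e Y.
Proof.
move=> /subsetP sXY; apply/subsetP=> y /nbrsP[x xX exy].
by apply/nbrsP; exists x; rewrite ?sXY.
Qed.

Lemma nbrsU e X Y : nbrs e (X :|: Y) = nbrs e X :|: nbrs e Y.
Proof.
apply/setP=> y; apply/nbrsP/setUP.
  by case=> x /setUP[] xX exy; [left | right]; apply/nbrsP; exists x.
by case=> /nbrsP[x xX exy]; exists x; rewrite // inE xX ?orbT.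
Qed.

Definition matching e X (f : T -> T) :=
  {in X &, injective f} /\ {in X, forall x, e x (f x)}.

(** Induction on [#|X|]. If a nonempty proper [Z] has no surplus of neighbours, [Z] and [X :\: Z]
    are matched separately; otherwise any edge at [x0] can be used first. *)
Lemma hall e X :
  (forall Z, Z \subset X -> #|Z| <= #|nbrs e Z|) -> exists f, matching e X f.
Proof.
move: {2}_.+1 (ltnSn #|X|) => n; elim: n e X => // n IHn e X ltXn hX.
have [->|[x0 x0X]] := set_0Vmem X.
  by exists id; split=> x; rewrite inE.
case: (pickP [pred Z : {set T} | [&& Z \proper X, Z != set0 & #|nbrs e Z| <= #|Z|]]).
- move=> Z /= /and3P[ZX Z0 leZ].
  have sZX := proper_sub ZX.
  have [||f1 [inj1 e1]] := IHn e Z.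
  + by apply: leq_trans (proper_card ZX) _; rewrite -ltnS.
  + by move=> Y sYZ; apply: hX; apply: subset_trans sYZ sZX.
  pose e' u v := e u v && (v \notin nbrs e Z).
  have [||f2 [inj2 e2]] := IHn e' (X :\: Z).
  + apply: leq_trans (_ : #|X| <= n); last by rewrite -ltnS.
    rewrite (cardsD X Z) (setIidPr sZX).
    have := subset_leq_card sZX; move: Z0; rewrite -card_gt0; lia.
  + move=> Y sY; have dYZ : Y :&: Z = set0.
      apply/setP=> y; rewrite !inE; apply/negP=> /andP[yY yZ].
      by have := subsetP sY _ yY; rewrite inE yZ.
    have := hX (Y :|: Z); rewrite subUset sZX (subset_trans sY (subsetDl _ _)).
    move=> /(_ isT); rewrite cardsU dYZ cards0 subn0.
    have -> : nbrs e (Y :|: Z) = nbrs e' Y :|: nbrs e Z.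
      apply/setP=> v; rewrite nbrsU !inE; case: (boolP [exists x in Z, e x v]) => [|nZ].
        by rewrite !orbT.
      rewrite !orbF; apply/exists_inP/exists_inP=> -[u uY]; last first.
        by case/andP; exists u.
      by move=> euv; exists u; rewrite // /e' euv inE nZ.
    rewrite cardsU; move: leZ; lia.
  exists (fun x => if x \in Z then f1 x else f2 x); split=> [x y xX yX|x xX].
    have eqF u v : u \in Z -> v \in X :\: Z -> f1 u = f2 v -> False.
      move=> uZ vXZ eq12; have /andP[_ /negP[]] := e2 _ vXZ.
      by rewrite -eq12; apply/nbrsP; exists u => //; apply: e1.
    case: ifP => [xZ|/negbT xZ]; case: ifP => [yZ|/negbT yZ].
    + exact: inj1.
    + by move=> eq12; case: (eqF x y) => //; rewrite inE yZ.
    + by move=> eq21; case: (eqF y x) => //; rewrite inE xZ.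
    + by apply: inj2; rewrite inE ?xZ ?yZ.
  case: ifP => [xZ|/negbT xZ]; first exact: e1.
  by have /andP[] : e' x (f2 x) by apply: e2; rewrite inE xZ.
- move=> noZ.
  have [y0 y0N] : exists y, e x0 y.
    have := hX [set x0]; rewrite sub1set cards1 => /(_ x0X).
    by case/card_gt0P=> y /nbrsP[x /set1P-> exy]; exists y.
  pose e' u v := e u v && (v != y0).
  have [||f [injf ef]] := IHn e' (X :\ x0).
  + by rewrite (cardsD1 x0 X) x0X in ltXn.
  + move=> Y sY; have [->|Y0] := eqVneq Y set0; first by rewrite cards0.
    have /= := noZ Y; rewrite Y0 (sub_proper_trans sY (properD1 x0X)) /=.
    move/negbT; rewrite -ltnNge => lt1; rewrite -ltnS; apply: leq_trans lt1 _.
    have -> : nbrs e' Y = nbrs e Y :\ y0.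
      apply/setP=> v; rewrite !inE; apply/exists_inP/andP.
        by case=> u uY /andP[euv ->]; split=> //; apply/exists_inP; exists u.
      by case=> vy /exists_inP[u uY euv]; exists u; rewrite // /e' euv.
    by rewrite (cardsD1 y0 (nbrs e Y)); case: (_ \in _).
  exists (fun x => if x == x0 then y0 else f x); split=> [x y xX yX|x xX].
    have fy0 z : z \in X -> z != x0 -> f z != y0.
      by move=> zX zx0; have /andP[] : e' z (f z) by apply: ef; rewrite !inE zx0.
    case: eqVneq => [->|xx0]; case: eqVneq => [->|yx0] // eqf.
    + by case/eqP: (fy0 _ yX yx0).
    + by case/eqP: (fy0 _ xX xx0).
    + by apply: injf; rewrite // !inE ?xx0 ?yx0.
  case: eqVneq => [->//|xx0].
  by have /andP[] : e' x (f x) by apply: ef; rewrite !inE xx0.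
Qed.

End Hall.

(** * Subgraphs all of whose edges are critical *)

Section Critical.
Variable T : finType.
Implicit Types (e : rel T) (A I : {set T}) (al : nat).

(* [independent] for a bare relation, so that edges can be deleted. *)
Definition indep e A := [forall x in A, forall y in A, ~~ e x y].

Lemma indepP e A : reflect {in A &, forall x y, ~~ e x y} (indep e A).
Proof.
apply: (iffP forall_inP) => [h x y xA yA|h x xA].
  by have /forall_inP-> := h x xA.
by apply/forall_inP=> y yA; apply: h.
Qed.

Lemma indepS e A I : A \subset I -> indep e I -> indep e A.
Proof.
move=> /subsetP sAI /indepP iI; apply/indepP=> x y xA yA.
by apply: iI; apply: sAI.
Qed.

Definition alpha_bound e al := forall A, indep e A -> #|A| <= al.

Definition edge_critical e al := forall x y, e x y ->
  exists I, [/\ x \in I, y \in I, #|I| = al.+1 &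
    {in I &, forall u v, e u v -> (u == x) && (v == y) || (u == y) && (v == x)}].

(** Take a minimal symmetric edge set that keeps the bound [al]. Dropping [x y] creates a larger
    independent set, which must contain both ends; without [x] it is independent in the graph
    itself, so its size is exactly [al.+1]. *)
Lemma critical_subgraph e0 al :
    symmetric e0 -> alpha_bound e0 al ->
  exists e, [/\ symmetric e, subrel e e0, alpha_bound e al & edge_critical e al].
Proof.
move=> sym0 bnd0.
pose rel_of (E : {set T * T}) : rel T := fun x y => (x, y) \in E.
pose P (E : {set T * T}) := [&& [forall x, forall y, rel_of E x y == rel_of E y x],
  [forall A : {set T}, indep (rel_of E) A ==> (#|A| <= al)] &
  [forall x, forall y, rel_of E x y ==> e0 x y]].
have PP E : reflect [/\ symmetric (rel_of E), alpha_bound (rel_of E) al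
                     & subrel (rel_of E) e0] (P E).
  apply: (iffP and3P) => -[h1 h2 h3]; split.
  - by move=> x y; have /forallP/(_ x)/forallP/(_ y)/eqP := h1.
  - by move=> A iA; have /forallP/(_ A)/implyP/(_ iA) := h2.
  - by move=> x y; have /forallP/(_ x)/forallP/(_ y)/implyP := h3.
  - by apply/forallP=> x; apply/forallP=> y; rewrite h1.
  - by apply/forallP=> A; apply/implyP=> /h2.
  - by apply/forallP=> x; apply/forallP=> y; apply/implyP=> /h3.
have : P [set p | e0 p.1 p.2].
  apply/PP; split=> [x y|A /indepP iA|x y]; rewrite /rel_of ?inE //.
  by apply: bnd0; apply/indepP=> x y xA yA; have := iA x y xA yA; rewrite /rel_of inE.
move=> /minset_exists[E /minsetP[/PP[symE bndE subE] minE] _].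
exists (rel_of E); split=> // x y exy.
pose E' := E :\ (x, y) :\ (y, x).
have E'E u v : rel_of E' u v =
    [&& (u, v) != (y, x), (u, v) != (x, y) & rel_of E u v].
  by rewrite /rel_of !inE.
have : ~~ P E'.
  apply/negP=> PE'; have sE : E' \subset E.
    by apply/subsetP=> -[u v] /= uv; have := E'E u v; rewrite /rel_of uv => /esym/and3P[].
  have := minE _ PE' sE => /(congr1 (fun F : {set T * T} => (x, y) \in F)).
  by rewrite /E' !inE eqxx andbF /=; rewrite /rel_of in exy; rewrite exy.
move=> nP; have symE' : symmetric (rel_of E').
  by move=> u v; rewrite !E'E symE !xpair_eqE andbCA andbA [RHS]andbA; congr andb;
     rewrite [(v == y) && _]andbC [(v == x) && _]andbC.
have subE' : subrel (rel_of E') (rel_of E) by move=> u v; rewrite E'E => /and3P[].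
case: (pickP [pred A : {set T} | indep (rel_of E') A & al < #|A|]) => [A|noA]; last first.
  case/negP: nP; apply/PP; split=> // [A iA|u v /subE' /subE //].
  by have /= := noA A; rewrite iA /= ltnNge => /negbFE.
case/andP=> /indepP iA ltA.
have edgeA : {in A &, forall u v, rel_of E u v ->
    (u == x) && (v == y) || (u == y) && (v == x)}.
  move=> u v uA vA euv; have := iA u v uA vA.
  by rewrite E'E euv andbT !xpair_eqE negb_and !negbK orbC.
have indepD z : z \in [:: x; y] -> indep (rel_of E) (A :\ z).
  rewrite !inE => zxy; apply/indepP=> u v; rewrite !inE => /andP[uz uA] /andP[vz vA].
  apply/negP=> /(edgeA _ _ uA vA) /orP[] /andP[/eqP eu /eqP ev];
    by case/orP: zxy => /eqP ez; rewrite eu ev ez eqxx in uz vz.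
have inA z : z \in [:: x; y] -> z \in A.
  move=> zxy; apply/negPn/negP=> zA; have := bndE _ (indepD z zxy).
  by rewrite leqNgt (setDidPl _) ?ltA // disjoint_sym disjoints1.
exists A; split=> //; rewrite ?inA ?inE ?eqxx ?orbT //.
apply/eqP; rewrite eqn_leq ltA andbT.
have := bndE _ (indepD x (mem_head _ _)).
by rewrite [#|A|](cardsD1 x) inA ?mem_head.
Qed.

End Critical.

(** * Orbits of a map that is injective on a set and fixes the rest *)

Section InjectiveIteration.
Variables (T : finType) (f : T -> T) (M : {set T}).
Hypotheses (f_inj : {in M &, injective f}) (f_fix : forall x, x \notin M -> f x = x).

Lemma iter_back x y k l :
    k <= l -> iter k f x = iter l f y ->
    (forall i, i < k -> iter i f x \in M) -> (forall i, i < l -> iter i f y \in M) ->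
  x = iter (l - k) f y.
Proof.
elim: k l => [|k IHk] [|l] //; rewrite !iterS subSS ltnS => le_kl eqf Mx My.
apply: IHk => // [|i ltik|i ltil]; [|exact: Mx (ltnW _)|exact: My (ltnW _)].
by apply: f_inj; rewrite ?Mx ?My.
Qed.

Lemma iter_fixed x k l : iter k f x \notin M -> k <= l -> iter l f x = iter k f x.
Proof.
move=> kM /subnK<-; elim: (l - k) => // m IHm.
by rewrite addSn iterS IHm f_fix.
Qed.

(** An orbit staying in [M] for [#|T|] steps repeats a value, and injectivity carries the repetition
    back to [x]. *)
Lemma iter_exit x : (forall k, iter k.+1 f x != x) -> iter #|T| f x \notin M.
Proof.
move=> noret; apply/negP=> endM.
have allM i : i <= #|T| -> iter i f x \in M.
  by move=> leiN; apply: contraLR endM => iM; rewrite (iter_fixed iM).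
have /injectivePn[i [j neq_ij eq_ij]] : ~~ injectiveb (fun i : 'I_#|T|.+1 => iter i f x).
  by apply/injectiveP => /leq_card; rewrite card_ord ltnn.
wlog lt_ij : i j neq_ij eq_ij / i < j.
  move=> W; case: (ltngtP i j) => [|lt_ji|/val_inj eqij]; first exact: W.
    by apply: (W j i) => //; rewrite eq_sym.
  by rewrite eqij eqxx in neq_ij.
have lej : j <= #|T| by rewrite -ltnS.
have := noret (j - i).-1; rewrite prednK ?subn_gt0 //.
rewrite -(iter_back (ltnW lt_ij) eq_ij) ?eqxx // => k lt_k; apply: allM; lia.
Qed.

(** Walking back from the common end by the smaller of the two first exit times puts one starting
    point on the orbit of the other. *)
Lemma iter_same_exit x y : iter #|T| f x \notin M -> iter #|T| f x = iter #|T| f y ->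
  (exists k, x = iter k f y) \/ (exists k, y = iter k f x).
Proof.
move=> xM eqxy; have yM : iter #|T| f y \notin M by rewrite -eqxy.
have first z : iter #|T| f z \notin M ->
    exists2 k, iter k f z = iter #|T| f z & forall i, i < k -> iter i f z \in M.
  move=> zM; case: (@ex_minnP (fun k => iter k f z \notin M)); first by exists #|T|.
  move=> k kM mink; exists k; first by rewrite (iter_fixed kM (mink _ zM)).
  by move=> i; apply: contraTT => /mink; rewrite -leqNgt.
have [k ek Mk] := first x xM; have [l el Ml] := first y yM.
case/orP: (leq_total k l) => le; [left; exists (l - k) | right; exists (k - l)].
- by apply: iter_back => //; rewrite ek el.
- by apply: iter_back => //; rewrite ek el.
Qed.

End InjectiveIteration.

(** * A generic matrix and linear dependencies *)

Section GenericWeights.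
Import GRing.Theory Num.Theory Order.TTheory.

Lemma binary_inj N (f g : nat -> bool) :
  \sum_(i < N) f i * 2 ^ i = \sum_(i < N) g i * 2 ^ i ->
  forall i, i < N -> f i = g i.
Proof.
elim: N f g => // N IHN f g; rewrite !big_ord_recl /= expn0 !muln1.
have dbl (h : nat -> bool) :
    \sum_(i < N) h (bump 0 i) * 2 ^ bump 0 i = (\sum_(i < N) h i.+1 * 2 ^ i).*2.
  rewrite -mul2n big_distrr /=; apply: eq_bigr => i _.
  by rewrite /bump leq0n add1n expnS mulnCA.
rewrite !dbl => eqfg.
have eq0 : f 0 = g 0.
  by have := congr1 odd eqfg; rewrite !oddD !odd_double !addbF; case: (f 0) (g 0) => -[].
case=> [//|i]; rewrite ltnS; apply: (IHN (f \o succn) (g \o succn)).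
by apply/double_inj/(@addnI (f 0)); rewrite {2}eq0.
Qed.

Lemma binary_set_inj (U : finType) :
  injective (fun X : {set U} => \sum_(p in X) 2 ^ enum_rank p).
Proof.
pose bit (Z : {set U}) i := if insub i is Some j then @enum_val U U j \in Z else false.
have E (Z : {set U}) : \sum_(p in Z) 2 ^ enum_rank p = \sum_(i < #|U|) bit Z i * 2 ^ i.
  rewrite big_mkcond (reindex (@enum_val U U)) /=; last first.
    by exists enum_rank => x _; [exact: enum_valK | exact: enum_rankK].
  by apply: eq_bigr => i _; rewrite enum_valK /bit valK; case: (_ \in _); rewrite ?mul1n.
move=> X Y /=; rewrite !E => /binary_inj eqXY.
apply/setP=> p; have := eqXY (enum_rank p) (ltn_ord _).
by rewrite /bit valK enum_rankK.
Qed.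

Local Open Scope ring_scope.

Variables (T : finType) (e : rel T).

(** Explicit integers in place of indeterminates: the product of the weights over a set of edges is
    2 to the binary code of that set. *)
Definition weight a b : int := if e a b then 2 ^+ (2 ^ enum_rank (a, b))%N else 0.

(* Distinct perfect matchings contribute distinct powers of 2 (up to sign) to
   the Leibniz expansion, so the smallest one cannot cancel. *)
Lemma weight_det_neq0 m (p q : 'I_m -> T) :
    injective p -> injective q -> (forall i, e (q i) (p i)) ->
  \det (\matrix_(i, j) weight (q i) (p j)) != 0.
Proof.
move=> inj_p inj_q e_qp.
pose good (s : 'S_m) := [forall i, e (q i) (p (s i))].
pose X (s : 'S_m) := [set (q i, p (s i)) | i : 'I_m].
pose W (s : 'S_m) := (\sum_(x in X s) 2 ^ enum_rank x)%N.
have injW : injective W.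
  move=> s s' /binary_set_inj eqX; apply/permP=> i.
  have : (q i, p (s i)) \in X s' by rewrite -eqX; apply: imset_f.
  by case/imsetP=> j _ [/inj_q <- /inj_p].
have termE (s : 'S_m) : \prod_i weight (q i) (p (s i)) =
    if good s then 2 ^+ W s else 0.
  case: ifP => [/forallP gs|/negbT].
    rewrite /W big_imset /=; last by move=> i j _ _ [/inj_q].
    by rewrite -prodrXr; apply: eq_bigr => i _; rewrite /weight gs.
  rewrite negb_forall => /existsP[i ne]; rewrite (bigD1 i) //=.
  by rewrite /weight (negPf ne) mul0r.
have good1 : good 1%g by apply/forallP=> i; rewrite perm1.
case: (arg_minnP W good1) => s0 gs0 minW.
rewrite /determinant (bigD1 s0) //=.
under eq_bigr => i _ do rewrite mxE.
rewrite termE gs0; apply/eqP=> /eqP; rewrite addr_eq0 => /eqP eq0.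
have : ((2 ^+ (W s0).+1 : int) %| (-1) ^+ s0 * 2 ^+ W s0)%Z.
  rewrite eq0 rpredN; apply: rpred_sum => s ss0.
  under eq_bigr => i _ do rewrite mxE.
  rewrite termE; case: ifP => [gs|_]; last by rewrite mulr0 dvdz0.
  apply: dvdz_mull; apply: dvdz_exp2l.
  by rewrite ltn_neqAle minW // andbT; apply: contra ss0 => /eqP/injW->.
by rewrite dvdzE abszMsign !abszX dvdn_Pexp2l ?ltnn.
Qed.

(** The rows [mu b] and columns [b], for [b] in [P], form an invertible square matrix by
    [weight_det_neq0]. *)
Lemma weight_kernel (P : {set T}) (mu : T -> T) (phi : T -> rat) :
    {in P &, injective mu} -> {in P, forall b, e (mu b) b} ->
    (forall b, b \notin P -> phi b = 0) ->
    {in P, forall b', \sum_b (weight (mu b') b)%:~R * phi b = 0} ->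
  forall b, phi b = 0.
Proof.
move=> inj_mu e_mu phiP ker b.
have [bP|/phiP//] := boolP (b \in P).
pose p (i : 'I_#|P|) := enum_val i.
pose M : 'M[int]_#|P| := \matrix_(i, j) weight (mu (p i)) (p j).
pose v : 'cV[rat]_#|P| := \col_j phi (p j).
have Mu : map_mx intr M \in @unitmx rat _.
  rewrite unitmxE det_map_mx unitfE intr_eq0; apply: weight_det_neq0.
  - exact: enum_val_inj.
  - by move=> i j /inj_mu eqij; apply: enum_val_inj; apply: eqij; apply: enum_valP.
  - by move=> i; apply: e_mu; apply: enum_valP.
have Mv : map_mx intr M *m v = 0.
  apply/colP=> i; rewrite !mxE -[RHS](ker (p i) (enum_valP i)).
  rewrite (bigID (mem P)) /= [X in _ = _ + X]big1 => [|x /phiP->]; last by rewrite mulr0.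
  by rewrite addr0 [RHS]big_enum_val; apply: eq_bigr => j _; rewrite !mxE.
have v0 : v = 0 by rewrite -(mulKmx Mu v) Mv mulmx0.
have := congr1 (fun u : 'cV[rat]_#|P| => u (enum_rank_in bP b) 0) v0.
by rewrite !mxE /p enum_rankK_in.
Qed.

Lemma underdetermined (F : fieldType) (U V : finType) (X : {set U}) (Y : {set V})
    (w : V -> U -> F) : (#|Y| < #|X|)%N ->
  exists phi, [/\ exists x, phi x != 0, forall x, x \notin X -> phi x = 0 &
    {in Y, forall y, \sum_x w y x * phi x = 0}].
Proof.
move=> ltYX; pose N : 'M[F]_(#|X|, #|Y|) := \matrix_(i, j) w (enum_val j) (enum_val i).
have /rowV0Pn[u] : kermx N != 0.
  rewrite -mxrank_eq0 mxrank_ker -lt0n subn_gt0.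
  exact: leq_ltn_trans (rank_leq_col N) ltYX.
move=> /sub_kermxP uN /rV0Pn[i ui].
(* At most one term: this is [u] extended by zero outside [X]. *)
pose phi x := \sum_(i | enum_val i == x) u 0 i.
have phiE j : phi (enum_val j) = u 0 j.
  by rewrite /phi (big_pred1 j) // => i0; rewrite /= (inj_eq enum_val_inj).
exists phi; split=> [|x xX|y yY].
- by exists (enum_val i); rewrite phiE.
- rewrite /phi big1 // => j /eqP ex.
  by rewrite -ex enum_valP in xX.
- rewrite (bigID (mem X)) /= [X in _ + X]big1 => [|x xX]; last first.
    rewrite /phi big1 ?mulr0 // => j /eqP ex.
    by rewrite -ex enum_valP in xX.
  have := congr1 (fun v : 'rV[F]_#|Y| => v 0 (enum_rank_in yY y)) uN.
  rewrite !mxE => uN0; rewrite addr0 -[RHS]uN0 [LHS]big_enum_val; apply: eq_bigr => j _.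
  by rewrite phiE !mxE enum_rankK_in // mulrC.
Qed.

(** These pairs and their swaps cover [setX D D] and overlap in the diagonal. *)
Lemma card_sym_pairs (D : {set T}) :
  (2 * #|[set q : T * T | [&& q.1 \in D, q.2 \in D & enum_rank q.1 <= enum_rank q.2]]|
   = #|D| * #|D|.+1)%N.
Proof.
set X := [set q | _].
pose swap (q : T * T) := (q.2, q.1).
have swapK : involutive swap by case.
pose Y := swap @^-1: X.
have cY : #|Y| = #|X|.
  by rewrite /Y -(can_imset_pre X swapK) card_imset //; apply: inv_inj.
have XU : X :|: Y = setX D D.
  apply/setP=> -[x y]; rewrite !inE /=.
  by case: (x \in D) (y \in D) => -[] //=; rewrite leq_total.
have XI : X :&: Y = [set (x, x) | x in D].
  apply/setP=> -[x y]; rewrite !inE /=; apply/andP/imsetP => [|[z zD [-> ->]]]; last first.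
    by rewrite zD leqnn.
  case=> /and3P[xD yD le1] /and3P[_ _ le2]; exists x => //; congr (_, _).
  by apply/enum_rank_inj/val_inj/anti_leq; rewrite le2.
have := cardsUI X Y; rewrite XU XI cY cardsX card_imset; last by move=> x y [].
by rewrite addnn -mul2n mulnS addnC.
Qed.

End GenericWeights.

(** * Tight sets of a critical graph *)

Section MaxIndependent.
Variables (T : finType) (e : rel T) (al : nat).
Hypotheses (e_sym : symmetric e) (e_irr : irreflexive e).
Hypotheses (e_bnd : alpha_bound e al) (e_crit : edge_critical e al).
Hypothesis e_avoid : forall S : {set T}, #|S| <= 3 ->
  exists I, [/\ indep e I, #|I| = al & {in S, forall x, x \notin I}].
Variable A : {set T}.
Hypotheses (indA : indep e A) (cardA : #|A| = al).
Implicit Types (X Y Z S U I : {set T}) (a b x y : T).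

Lemma indepU X Y : indep e X -> indep e Y ->
  {in X & Y, forall x y, ~~ e x y} -> indep e (X :|: Y).
Proof.
move=> /indepP iX /indepP iY XY; apply/indepP=> x y /setUP[] xX /setUP[] yX.
- exact: iX.
- exact: XY.
- by rewrite e_sym; apply: XY.
- exact: iY.
Qed.

(** With at most two neighbours, [v] and its neighbours could all be avoided by an independent set
    of size [al], to which [v] could be added. *)
Lemma min_degree v : 3 <= #|nbrs e [set v]|.
Proof.
rewrite ltnNge; apply/negP=> le2.
have [|J [iJ cJ dJ]] := e_avoid (S := v |: nbrs e [set v]).
  by apply: leq_trans (leq_card_setU _ _) _; rewrite cards1.
have vJ : v \notin J by apply: dJ; rewrite !inE eqxx.
suff /e_bnd : indep e (v |: J) by rewrite cardsU1 vJ cJ ltnn.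
apply: indepU => // [|x y /set1P-> yJ].
  by apply/indepP=> x y /set1P-> /set1P->; rewrite e_irr.
apply: contraL yJ => vy; apply: dJ; rewrite in_setU1; apply/orP; right.
by apply/nbrsP; exists v; rewrite ?inE.
Qed.

(** Let [J] be a maximum independent set missing a point of [X]. Exchanging [J :&: nbrs e X] for
    [X :\: J] shows that the latter is not larger; the smaller set [X :&: J] is handled by induction
    and has its neighbours in [nbrs e X :\: J]. *)
Lemma independent_hall X : indep e X -> #|X| <= #|nbrs e X|.
Proof.
move: {2}_.+1 (ltnSn #|X|) => n; elim: n X => // n IHn X ltXn iX.
have [->|[x0 x0X]] := set_0Vmem X; first by rewrite cards0.
have [|J [iJ cJ dJ]] := e_avoid (S := [set x0]); first by rewrite cards1.
have x0J : x0 \notin J by apply: dJ; rewrite inE eqxx.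
have ltXJ : #|X :&: J| < #|X|.
  apply: proper_card; apply/properP; split; first exact: subsetIl.
  by exists x0 => //; rewrite inE (negPf x0J) andbF.
have leXJ : #|X :&: J| <= #|nbrs e (X :&: J)|.
  by apply: IHn; [apply: leq_trans ltXJ _ | apply: indepS iX; apply: subsetIl].
have /e_bnd : indep e ((J :\: nbrs e X) :|: X).
  apply: indepU => // [|x y]; first by apply: indepS iJ; apply: subsetDl.
  rewrite inE => /andP[xN _] yX; apply: contra xN => xy.
  by apply/nbrsP; exists y; rewrite // e_sym.
have sNJ : nbrs e (X :&: J) \subset nbrs e X :\: J.
  apply/subsetP=> y yN; rewrite inE (subsetP (nbrsS _ (subsetIl _ _)) _ yN) andbT.
  apply/negP=> yJ; case/nbrsP: yN => x /setIP[_ xJ] xy.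
  by move/indepP: iJ => /(_ x y xJ yJ); rewrite xy.
have XN : (J :\: nbrs e X) :&: X = X :&: J.
  apply/setP=> x; rewrite !in_setI in_setD andbC; have [xX|//] := boolP (x \in X).
  case: (boolP (x \in nbrs e X)) => [/nbrsP[y yX yx]|//].
  by move/indepP: iX => /(_ y x yX xX); rewrite yx.
rewrite cardsU XN -cJ -(cardsID (nbrs e X) J).
have := subset_leq_card sNJ; rewrite -(cardsID J (nbrs e X)) [J :&: _]setIC.
have := subset_leq_card (subsetIl X J); lia.
Qed.

Definition nbrsA := nbrs [rel x y | e x y && (y \in A)].

Lemma nbrsAP Y a : reflect (exists2 y, y \in Y & e y a && (a \in A)) (a \in nbrsA Y).
Proof. exact: nbrsP. Qed.

Lemma nbrsA_sub Y : nbrsA Y \subset A.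
Proof. by apply/subsetP=> a /nbrsAP[y _ /andP[]]. Qed.

(** Replacing [nbrsA Y] by [Y] in [A] gives an independent set. *)
Lemma leq_nbrsA Y : Y \subset ~: A -> indep e Y -> #|Y| <= #|nbrsA Y|.
Proof.
move=> sYB iY; have /e_bnd : indep e (Y :|: (A :\: nbrsA Y)).
  apply: indepU => // [|y a yY]; first by apply: indepS indA; apply: subsetDl.
  rewrite inE => /andP[aN aA]; apply: contra aN => ya.
  by apply/nbrsAP; exists y; rewrite ?ya.
have -> : #|Y :|: (A :\: nbrsA Y)| = #|Y| + #|A :\: nbrsA Y|.
  rewrite cardsU (_ : Y :&: _ = set0) ?cards0 ?subn0 //.
  apply/setP=> y; rewrite !inE; apply/negP=> /andP[/(subsetP sYB)].
  by rewrite inE => /negP yA /andP[_].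
rewrite cardsD (setIidPr (nbrsA_sub _)) cardA.
have := subset_leq_card (nbrsA_sub Y); rewrite cardA; lia.
Qed.

Lemma adjA_notin a y : a \in A -> e a y -> y \notin A.
Proof. by move=> aA ay; apply/negP=> yA; move/indepP: indA => /(_ a y aA yA); rewrite ay. Qed.

Definition tight Y := [&& Y \subset ~: A, indep e Y & #|nbrsA Y| == #|Y|].

Lemma tight0 : tight set0.
Proof.
rewrite /tight sub0set /=; apply/andP; split.
  by apply/indepP=> x y; rewrite inE.
by rewrite cards0 cards_eq0 -subset0; apply/subsetP=> a /nbrsAP[y]; rewrite inE.
Qed.

(** A matching of [A] that sends [nbrsA U] onto [U] works for every tight [S] inside [U]: the
    vertices matched into [S] are [#|S|] many and lie in [nbrsA S], which has the same size. *)
Lemma tight_matching U : tight U ->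
  exists mu : T -> T, [/\ {in A &, injective mu}, {in A, forall a, e a (mu a)} &
    forall S, tight S -> S \subset U -> {in A, forall a, (mu a \in S) = (a \in nbrsA S)}].
Proof.
case/and3P=> sUB iU /eqP tU.
pose e2 a b := e a b && ((a \in nbrsA U) ==> (b \in U)).
have [|mu [inj_mu e_mu]] := @hall _ e2 A.
  move=> X sXA; pose X1 := X :&: nbrsA U; pose X2 := X :\: nbrsA U.
  (* The part of [U] not adjacent to [X1] has its neighbours in [nbrsA U :\: X1]; compare sizes
     using that [U] is tight. *)
  have leX1 : #|X1| <= #|nbrs e X1 :&: U|.
    have sU' : nbrsA (U :\: nbrs e X1) \subset nbrsA U :\: X1.
      apply/subsetP=> a aN; rewrite inE (subsetP (nbrsS _ (subsetDl _ _)) _ aN) andbT.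
      case/nbrsAP: aN => u; rewrite inE => /andP[uN _] /andP[ua _].
      by apply: contra uN => aX; apply/nbrsP; exists a; rewrite // e_sym.
    have := leq_trans (leq_nbrsA (subset_trans (subsetDl _ _) sUB)
      (indepS (subsetDl _ _) iU)) (subset_leq_card sU').
    rewrite !cardsD tU [U :&: _]setIC (setIidPr (subsetIr _ _)).
    have := subset_leq_card (subsetIr X (nbrsA U)).
    by have := subset_leq_card (subsetIr (nbrs e X1) U); rewrite tU -/X1; lia.
  have leX2 : #|X2| <= #|nbrs e X2|.
    by apply: independent_hall; apply: indepS indA; apply: subset_trans (subsetDl _ _) sXA.
  have dN : nbrs e X2 :&: U = set0.
    apply/setP=> u; rewrite in_setI in_set0; apply/negP=> /andP[/nbrsP[x]].
    rewrite inE => /andP[xN xX] xu uU; case/negP: xN; apply/nbrsAP; exists u => //.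
    by rewrite e_sym xu (subsetP sXA).
  have sN : (nbrs e X1 :&: U) :|: nbrs e X2 \subset nbrs e2 X.
    apply/subsetP=> v /setUP[/setIP[/nbrsP[x /setIP[xX _] xv] vU]|/nbrsP[x]].
      by apply/nbrsP; exists x; rewrite // /e2 xv vU implybT.
    rewrite inE => /andP[xN xX] xv.
    by apply/nbrsP; exists x; rewrite // /e2 xv (negPf xN).
  have := subset_leq_card sN; rewrite cardsU setIAC (_ : nbrs e X1 :&: _ :&: U = set0).
    rewrite cards0 subn0; apply: leq_trans.
    by rewrite -(cardsID (nbrsA U) X); apply: leq_add.
  by rewrite -setIA dN setI0.
exists mu; split=> // [a aA|S]; first by have /andP[] := e_mu a aA.
case/and3P=> _ iS /eqP tS sSU.
have muU : mu @: nbrsA U = U.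
  apply/eqP; rewrite eqEcard; apply/andP; split.
    apply/subsetP=> _ /imsetP[a aN ->].
    by have /andP[_] := e_mu a (subsetP (nbrsA_sub _) _ aN); rewrite aN.
  rewrite card_in_imset ?tU // => a a' aN a'N.
  by apply: inj_mu; apply: (subsetP (nbrsA_sub _)); eassumption.
have sub a : a \in A -> mu a \in S -> a \in nbrsA S.
  move=> aA aS; apply/nbrsAP; exists (mu a) => //; rewrite aA e_sym.
  by have /andP[->] := e_mu a aA.
pose P := [set a in A | mu a \in S].
have PE : P = nbrsA S.
  apply/eqP; rewrite eqEcard tS; apply/andP; split.
    by apply/subsetP=> a; rewrite inE => /andP[]; apply: sub.
  suff sSP : S \subset mu @: P.
    by apply: leq_trans (subset_leq_card sSP) (leq_imset_card _ _).
  apply/subsetP=> s sS; have := subsetP sSU _ sS; rewrite -{1}muU.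
  case/imsetP=> a /(subsetP (nbrsA_sub _)) aA es; apply/imsetP; exists a => //.
  by rewrite inE aA -es.
by move=> a aA; rewrite -PE inE aA.
Qed.

Lemma card_critical_outside I : #|I| = al.+1 -> #|I :\: A| = (#|A :\: I|).+1.
Proof. by have := cardsID A I; have := cardsID I A; rewrite setIC cardA; lia. Qed.

(** With [I] the witness of criticality, [S] is [I :\: A] without [b]. Its neighbours lie in
    [A :\: I], which has size [#|S|], so [S] is tight; adding [b] adds only the neighbour [a]. *)
Lemma flexible_edge a b : a \in A -> e a b ->
  exists S, [/\ tight S, b \notin S, tight (b |: S),
    a \notin nbrsA S & nbrsA (b |: S) = a |: nbrsA S].
Proof.
move=> aA ab; have bNA := adjA_notin aA ab.
have [I [aI bI cI eI]] := e_crit ab.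
have cIA := card_critical_outside cI.
have aNb : a != b by apply: contraTneq ab => ->; rewrite e_irr.
pose S := (I :\: A) :\ b; have SE : b |: S = I :\: A.
  by rewrite setD1K // inE bNA.
have bS : b \notin S by rewrite !inE eqxx.
have cS : #|S| = #|A :\: I|.
  by have := cardsU1 b S; rewrite SE bS cIA; lia.
have sSB : b |: S \subset ~: A by rewrite SE; apply/subsetP=> x; rewrite !inE => /andP[].
have iS : indep e (b |: S).
  apply/indepP=> x y; rewrite SE !inE => /andP[xA xI] /andP[yA yI]; apply/negP.
  move/(eI _ _ xI yI) => /orP[] /andP[/eqP ex /eqP ey];
    by [rewrite ex aA in xA | rewrite ey aA in yA].
have sNS : nbrsA S \subset A :\: I.
  apply/subsetP=> x /nbrsAP[y]; rewrite !inE => /and3P[yb yA yI] /andP[yx ->].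
  rewrite andbT; apply/negP=> xI; case/orP: (eI _ _ yI xI yx) => /andP[/eqP ey _].
    by rewrite ey aA in yA.
  by rewrite ey eqxx in yb.
have iS' : indep e S by apply: indepS iS; apply: subsetUr.
have sSB' : S \subset ~: A by apply: subset_trans sSB; apply: subsetUr.
have NSE : nbrsA S = A :\: I.
  by apply/eqP; rewrite eqEcard sNS -cS leq_nbrsA.
have NbE : nbrsA (b |: S) = a |: nbrsA S.
  apply/eqP; rewrite eqEsubset; apply/andP; split; last first.
    rewrite subUset nbrsS ?subsetUr // andbT sub1set; apply/nbrsAP.
    by exists b; rewrite ?setU11 // aA andbT e_sym.
  rewrite /nbrsA nbrsU subUset [X in _ && X]subsetUr andbT; apply/subsetP=> x.
  case/nbrsAP=> y /set1P-> /andP[bx xA]; rewrite in_setU1 -/nbrsA NSE inE xA andbT.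
  have [xI|] := boolP (x \in I); rewrite ?orbT // orbF.
  case/orP: (eI _ _ bI xI bx) => /andP[/eqP eb]; last by [].
  by move=> _; rewrite eb aA in bNA.
have aNS : a \notin nbrsA S by rewrite NSE inE aI.
exists S; split=> //; rewrite /tight.
  by rewrite sSB' iS' NSE cS eqxx.
by rewrite sSB iS NbE !cardsU1 bS aNS NSE cS eqxx.
Qed.

(** Here [Y] is [I :\: A] for the witness [I]. Its excess over [nbrsA Y] will yield a kernel
    vector. *)
Lemma critical_edge_outside x y : x \notin A -> y \notin A -> e x y ->
  exists Y, [/\ Y \subset ~: A, x \in Y, y \in Y, #|nbrsA Y| < #|Y| &
    {in Y &, forall u v, e u v -> (u == x) && (v == y) || (u == y) && (v == x)}].
Proof.
move=> xA yA xy; have [I [xI yI cI eI]] := e_crit xy.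
have cIA := card_critical_outside cI.
exists (I :\: A); split; rewrite ?inE ?xA ?yA //.
- by apply/subsetP=> u; rewrite !inE => /andP[].
- rewrite cIA ltnS; apply: subset_leq_card; apply/subsetP=> a.
  case/nbrsAP=> u; rewrite !inE => /andP[uA uI] /andP[ua aA]; rewrite aA andbT.
  apply/negP=> aI; case/orP: (eI _ _ uI aI ua) => /andP[_ /eqP ea];
    by [rewrite ea (negPf yA) in aA | rewrite ea (negPf xA) in aA].
- by move=> u v; rewrite !inE => /andP[_ uI] /andP[_ vI]; apply: eI.
Qed.

(** Comparing ranks selects one orientation of each edge outside [A]. *)
Definition edges_out : {set T * T} :=
  [set p | [&& p.1 \notin A, p.2 \notin A, e p.1 p.2 & enum_rank p.1 < enum_rank p.2]].

Lemma edges_outP p : p \in edges_out -> [/\ p.1 \notin A, p.2 \notin A & e p.1 p.2].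
Proof. by rewrite inE => /and4P[]. Qed.

Lemma edges_out_eq p q : p \in edges_out -> q \in edges_out ->
  (q.1 == p.1) && (q.2 == p.2) || (q.1 == p.2) && (q.2 == p.1) -> q = p.
Proof.
case: p q => p1 p2 [q1 q2]; rewrite !inE /= => /and4P[_ _ _ lp] /and4P[_ _ _ lq].
case/orP=> /andP[/eqP e1 /eqP e2]; first by rewrite e1 e2.
by rewrite e1 e2 ltnNge ltnW in lq.
Qed.

(** * Bounding the edges outside [A] by linear algebra *)

Section Rank.
Import GRing.Theory.
Local Open Scope ring_scope.

Lemma independent_matching Y : Y \subset ~: A -> indep e Y ->
  exists mu : T -> T, [/\ {in Y &, injective mu}, {in Y, forall b, e (mu b) b} &
    {in Y, forall b, mu b \in nbrsA Y}].
Proof.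
move=> sYB iY; have [|mu [inj_mu e_mu]] := @hall _ [rel x y | e x y && (y \in A)] Y.
  move=> Z sZY; apply: leq_nbrsA; [exact: subset_trans sZY sYB | exact: indepS iY].
exists mu; split=> // b bY; have /andP[eb bA] := e_mu b bY; first by rewrite e_sym.
by apply/nbrsAP; exists b; rewrite ?eb.
Qed.

Definition kernel_vector (phi : T -> rat) :=
  {in A, forall a, phi a = 0} /\ {in A, forall a, \sum_b (weight e a b)%:~R * phi b = 0}.

(** The set [Y] of [critical_edge_outside] has fewer neighbours in [A] than elements, so it supports
    a nonzero kernel vector. As [p] is the only edge inside [Y], any other edge has an end outside
    the support. *)
Lemma edge_kernel_vector p : p \in edges_out -> exists phi, [/\ kernel_vector phi,
  phi p.1 * phi p.2 != 0 & {in edges_out, forall q, q != p -> phi q.1 * phi q.2 = 0}].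
Proof.
move=> pE; have [p1A p2A ep] := edges_outP pE.
have [Y [sYB p1Y p2Y ltY eY]] := critical_edge_outside p1A p2A ep.
have [phi [[b0 phib0] phiY ker]] :=
  underdetermined (fun a b => (weight e a b)%:~R : rat) ltY.
have phiA : {in A, forall a, phi a = 0}.
  by move=> a aA; apply: phiY; apply: contraL aA => /(subsetP sYB); rewrite inE.
have kerA : {in A, forall a, \sum_b (weight e a b)%:~R * phi b = 0}.
  move=> a aA; have [/ker //|aN] := boolP (a \in nbrsA Y).
  rewrite big1 // => b _; have [bY|/phiY->] := boolP (b \in Y); last by rewrite mulr0.
  rewrite /weight; case: ifP => [ab|_]; last by rewrite mulr0z mul0r.
  by case/negP: aN; apply/nbrsAP; exists b; rewrite // e_sym ab.
(* If [phi z] were zero, the support would lie in an independent set, which is matched into [A], and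
   [weight_kernel] would give zero. *)
have nz z : z \in Y -> indep e (Y :\ z) -> phi z != 0.
  move=> zY iY; apply/eqP=> phiz; case/eqP: phib0.
  have [|mu [inj_mu e_mu muN]] := independent_matching _ iY.
    by apply: subset_trans (subsetDl _ _) sYB.
  apply: (weight_kernel inj_mu e_mu) => [b|b bY].
    by rewrite !inE negb_and negbK => /orP[/eqP->|/phiY].
  by apply: kerA; apply: (subsetP (nbrsA_sub _) _ (muN b bY)).
exists phi; split=> //.
  rewrite mulf_neq0 // nz //; apply/indepP=> u v; rewrite !inE;
    case/andP=> up uY /andP[vp vY]; apply/negP=> /(eY _ _ uY vY);
    by rewrite (negPf up) (negPf vp) ?andbF.
move=> q qE; apply: contraNeq => nzq.
have inY x : phi x != 0 -> x \in Y by apply: contraNT => /phiY->.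
move: nzq; rewrite mulf_eq0 negb_or => /andP[/inY q1Y /inY q2Y].
have [_ _ eq] := edges_outP qE.
by apply/eqP; apply: edges_out_eq => //; apply: eY.
Qed.

(* The kernel has dimension [#|~: A| - al], and the quadratic forms attached to
   the edges are linearly independent on it. *)
Lemma card_edges_out :
  (2 * #|edges_out| <= (#|~: A| - al) * (#|~: A| - al).+1)%N.
Proof.
have [mu [inj_mu e_mu _]] := tight_matching tight0.
(* A kernel vector is determined by its values on the unmatched set [D]. *)
pose P := mu @: A; pose D := ~: A :\: P.
have sPB : P \subset ~: A.
  by apply/subsetP=> _ /imsetP[a aA ->]; rewrite inE; apply: (adjA_notin aA) => //; apply: e_mu.
have cD : #|D| = (#|~: A| - al)%N.
  by rewrite cardsD (setIidPr sPB) card_in_imset ?cardA.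
rewrite -cD -card_sym_pairs leq_mul2l /= leqNgt; apply/negP=> ltS.
have [|Phi PhiP] := @fin_all_exists _ (fun=> T -> rat) (fun p phi => p \in edges_out ->
  [/\ kernel_vector phi, phi p.1 * phi p.2 != 0 &
      {in edges_out, forall q, q != p -> phi q.1 * phi q.2 = 0}]).
  move=> p; have [pE|] := boolP (p \in edges_out); last by exists (fun=> 0).
  by have [phi] := edge_kernel_vector pE; exists phi.
(* With more edges than unordered pairs in [D], some nontrivial combination [Theta] of the forms
   [Phi p k * Phi p l] vanishes on [D]. *)
have [lam [[p0 lamp0] lam0 lamS]] :=
  underdetermined (fun (q p : T * T) => Phi p q.1 * Phi p q.2) ltS.
have p0E : p0 \in edges_out by apply: contraNT lamp0 => /lam0->.
pose Theta k l := \sum_p Phi p k * Phi p l * lam p.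
have ThetaC k l : Theta k l = Theta l k.
  by apply: eq_bigr => p _; rewrite [Phi p k * _]mulrC.
have ThetaA k l : k \in A -> Theta k l = 0.
  move=> kA; apply: big1 => p _; have [pE|/lam0->] := boolP (p \in edges_out).
    by have [[Phi0 _] _ _] := PhiP p pE; rewrite Phi0 // !mul0r.
  by rewrite mulr0.
have ThetaK l a : a \in A -> \sum_b (weight e a b)%:~R * Theta b l = 0.
  move=> aA; under eq_bigr => b _ do rewrite mulr_sumr.
  rewrite exchange_big big1 //= => p _.
  have [pE|/lam0->] := boolP (p \in edges_out); last first.
    by rewrite big1 // => b _; rewrite !mulr0.
  have [[_ /(_ a aA) kerp] _ _] := PhiP p pE.
  under eq_bigr => b _ do rewrite !mulrA.
  by rewrite -!mulr_suml kerp !mul0r.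
have ThetaD k l : k \in D -> l \in D -> Theta k l = 0.
  move=> kD lD; wlog le_kl : k l kD lD / (enum_rank k <= enum_rank l)%N.
    by move=> W; case/orP: (leq_total (enum_rank k) (enum_rank l)) => le;
      [|rewrite ThetaC]; apply: W.
  by apply: (lamS (k, l)); rewrite inE /= kD lD.
pose nu b := odflt b [pick a in A | mu a == b].
have nuK a : a \in A -> nu (mu a) = a.
  move=> aA; rewrite /nu; case: pickP => [a' /andP[a'A /eqP/inj_mu->]|/(_ a)] //.
  by rewrite aA eqxx.
have ker0 l : {in D, forall k, Theta k l = 0} -> forall k, Theta k l = 0.
  move=> ThD; apply: (@weight_kernel _ e P nu) => [x y|x|b|x].
  - by move=> /imsetP[a aA ->] /imsetP[a' a'A ->]; rewrite !nuK // => ->.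
  - by move=> /imsetP[a aA ->]; rewrite nuK // e_mu.
  - move=> bP; have [/ThetaA//|bA] := boolP (b \in A).
    by apply: ThD; rewrite !inE bP.
  - by move=> /imsetP[a aA ->]; rewrite nuK // ThetaK.
have Theta0 k l : Theta k l = 0.
  by apply: (ker0 l) => {}k kD; rewrite ThetaC; apply: (ker0 k) => j jD; apply: ThetaD.
(* At the ends of [p0] only the term of [p0] survives, and it is nonzero. *)
have := Theta0 p0.1 p0.2; rewrite /Theta (bigD1 p0) //= big1 => [|p pp0].
  have [_ nz _] := PhiP p0 p0E; rewrite addr0 => /eqP.
  by rewrite mulf_eq0 (negPf nz) (negPf lamp0).
have [pE|/lam0->] := boolP (p \in edges_out); last by rewrite mulr0.
by have [_ _ ->] := PhiP p pE; rewrite ?mul0r // eq_sym.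
Qed.

End Rank.

(** * Classes of tight sets *)

Definition cover_out := [set p.1 | p in edges_out].

Lemma cover_outP x y : x \notin A -> y \notin A -> e x y ->
  (x \in cover_out) || (y \in cover_out).
Proof.
move=> xA yA xy; case: (ltngtP (enum_rank x) (enum_rank y)) => [lt|lt|/val_inj/enum_rank_inj eqxy].
- by apply/orP; left; apply/imsetP; exists (x, y); rewrite // inE xA yA xy lt.
- by apply/orP; right; apply/imsetP; exists (y, x); rewrite // inE xA yA e_sym xy lt.
- by rewrite eqxy e_irr in xy.
Qed.

Definition class (c S : {set T}) := tight S && (S :&: cover_out == c).

(** An edge between [S1] and [S2] has an end in [cover_out]; equal traces put that end in both sets,
    against independence. Tightness follows from submodularity of [#|nbrsA _|] and [leq_nbrsA]. *)
Lemma classU c S1 S2 : class c S1 -> class c S2 -> class c (S1 :|: S2).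
Proof.
case/andP=> /and3P[sB1 i1 /eqP t1] /eqP c1 /andP[/and3P[sB2 i2 /eqP t2] /eqP c2].
have sB : S1 :|: S2 \subset ~: A by rewrite subUset sB1.
have iU : indep e (S1 :|: S2).
  apply: indepU => // x y xS yS; apply/negP=> xy.
  have nA z S : S \subset ~: A -> z \in S -> z \notin A.
    by move=> sS /(subsetP sS); rewrite inE.
  have inC z : z \in cover_out -> (z \in S1) = (z \in S2).
    by move=> zC; have := congr1 (fun X : {set T} => z \in X) (etrans c1 (esym c2));
      rewrite !inE zC !andbT.
  case/orP: (cover_outP (nA _ _ sB1 xS) (nA _ _ sB2 yS) xy) => [/inC|/inC].
    by rewrite xS => /esym x2; move/indepP: i2 => /(_ x y x2 yS); rewrite xy.
  by rewrite yS => y1; move/indepP: i1 => /(_ x y xS y1); rewrite xy.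
rewrite /class setIUl c1 c2 setUid eqxx andbT /tight sB iU /=.
rewrite eqn_leq leq_nbrsA // andbT /nbrsA nbrsU -/nbrsA.
have iI : #|S1 :&: S2| <= #|nbrsA (S1 :&: S2)|.
  apply: leq_nbrsA; first by apply: subset_trans (subsetIl _ _) sB1.
  by apply: indepS i1; apply: subsetIl.
have sI : nbrsA (S1 :&: S2) \subset nbrsA S1 :&: nbrsA S2.
  by rewrite subsetI !nbrsS ?subsetIl ?subsetIr.
have := cardsUI S1 S2; have := cardsUI (nbrsA S1) (nbrsA S2).
by have := leq_trans iI (subset_leq_card sI); rewrite t1 t2; lia.
Qed.

Definition class_matching c (mu : T -> T) :=
  [/\ {in A &, injective mu}, {in A, forall a, e a (mu a)} &
   forall S, class c S -> {in A, forall a, (mu a \in S) = (a \in nbrsA S)}].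

(** Closure under union gives a nonempty class a largest member, to which [tight_matching] applies;
    for an empty class [set0] serves. *)
Lemma class_matchings : exists mu : {set T} -> T -> T,
  forall c, class_matching c (mu c).
Proof.
apply: (@fin_all_exists _ (fun=> T -> T) class_matching) => c.
have [U tU maxU] : exists2 U, tight U & forall S, class c S -> S \subset U.
  case: (pickP (class c)) => [S0 cS0|no]; last first.
    by exists set0; [exact: tight0 | move=> S; rewrite no].
  case: (arg_maxnP (fun S : {set T} => #|S|) cS0) => U cU maxU.
  exists U => [|S cS]; first by case/andP: cU.
  have /eqP-> : U == U :|: S by rewrite eqEcard subsetUl; apply: maxU (classU cU cS).
  exact: subsetUr.
have [mu [inj_mu e_mu muP]] := tight_matching tU.
exists mu; split=> // S cS; apply: muP (maxU S cS).
by case/andP: cS.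
Qed.

(** * Alternating paths of two class matchings *)

Section Shift.
Variable mu : {set T} -> T -> T.
Hypothesis muP : forall c, class_matching c (mu c).

(* One step along the path of [mu c1] and [mu c2] edges, from a vertex matched
   by [mu c2]; the other vertices are fixed. *)
Definition shift c1 c2 b :=
  if [pick a in A | mu c2 a == b] is Some a then mu c1 a else b.

Lemma shift_mu c1 c2 a : a \in A -> shift c1 c2 (mu c2 a) = mu c1 a.
Proof.
move=> aA; rewrite /shift; have [inj_mu _ _] := muP c2.
case: pickP => [a' /andP[a'A /eqP/inj_mu->]|/(_ a)] //.
by rewrite aA eqxx.
Qed.

Lemma shift_fix c1 c2 b : b \notin mu c2 @: A -> shift c1 c2 b = b.
Proof.
move=> bN; rewrite /shift; case: pickP => // a /andP[aA /eqP eb].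
by case/imsetP: bN; exists a.
Qed.

Lemma shift_inj c1 c2 : {in mu c2 @: A &, injective (shift c1 c2)}.
Proof.
move=> _ _ /imsetP[a aA ->] /imsetP[a' a'A ->]; rewrite !shift_mu //.
by have [inj_mu _ _] := muP c1 => /inj_mu->.
Qed.

(** If [mu c2 a] is in [S], then [a] is a neighbour of [S], so [mu c1] matches it into [S]. *)
Lemma iter_shift_in c1 c2 S b k : class c1 S -> b \in S -> iter k (shift c1 c2) b \in S.
Proof.
move=> cS bS; elim: k => //= k; move: (iter _ _ _) => {bS}b bS.
have [/imsetP[a aA eb]|/shift_fix->//] := boolP (b \in mu c2 @: A).
have [_ _ /(_ S cS a aA)] := muP c1; rewrite eb shift_mu // => ->.
have [_ e2 _] := muP c2.
by apply/nbrsAP; exists b; rewrite // eb e_sym e2.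
Qed.

Lemma iter_shift_notin c1 c2 S b k :
  class c2 S -> b \notin S -> iter k (shift c1 c2) b \notin S.
Proof.
move=> cS bS; elim: k => //= k; move: (iter _ _ _) => {bS}b bS.
have [/imsetP[a aA eb]|/shift_fix->//] := boolP (b \in mu c2 @: A).
have [_ _ /(_ S cS a aA)] := muP c2; rewrite eb in bS *; rewrite shift_mu // (negPf bS).
move/esym/negbT; apply: contra => aS; have [_ e1 _] := muP c1.
by apply/nbrsAP; exists (mu c1 a); rewrite // e_sym e1.
Qed.

Definition flexible c b a := exists S,
  [/\ class c S, class c (b |: S), b \notin S, a \in A &
      mu c a = b /\ {in A, forall a', e a' b -> a' != a -> a' \in nbrsA S}].

(** The class is the trace of the set [S] from [flexible_edge]. Adding [b] keeps the trace, and
    compatibility with both sets forces [mu c a = b]. *)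
Lemma flexible_class b a : b \notin cover_out -> a \in A -> e a b ->
  exists2 c : {set T}, c \subset cover_out & flexible c b a.
Proof.
move=> bC aA ab; have [S [tS bS tbS aS NE]] := flexible_edge aA ab.
pose c := S :&: cover_out; have cS : class c S by rewrite /class tS eqxx.
have cbS : class c (b |: S).
  rewrite /class tbS setIUl (_ : [set b] :&: cover_out = set0).
    by rewrite set0U eqxx.
  by apply/setP=> x; rewrite !inE; apply: contraNF bC => /andP[/eqP->].
have [inj_mu e_mu muS] := muP c.
exists c; first exact: subsetIr.
exists S; split=> //; split.
  have := muS _ cbS a aA; rewrite NE setU11 inE (muS _ cS a aA) (negPf aS) orbF.
  by rewrite inE => /eqP.
move=> a' a'A a'b a'a.
have : a' \in nbrsA (b |: S).
  by apply/nbrsAP; exists b; rewrite ?setU11 // a'A e_sym a'b.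
by rewrite NE in_setU1 (negPf a'a).
Qed.

(** The path cannot close up: its first step goes from [b] to [mu c1 a2], which lies in [S] because
    [a2 != a1]; from there it stays in [S], which misses [b]. *)
Lemma flexible_exit c1 c2 b a1 a2 : flexible c1 b a1 -> flexible c2 b a2 -> a1 != a2 ->
  iter #|T| (shift c1 c2) b \notin mu c2 @: A.
Proof.
move=> [S [cS _ bS _ [_ NS]]] [_ [_ _ _ a2A [mu2 _]]] a12.
apply: iter_exit => [||k]; [exact: shift_inj | exact: shift_fix |].
have [_ e1 mu1S] := muP c1; have [_ e2 _] := muP c2.
apply: contraNneq bS => {1}<-; rewrite iterSr; apply: iter_shift_in => //.
rewrite -{1}mu2 shift_mu // mu1S // NS //; last by rewrite eq_sym.
by rewrite -mu2 e2.
Qed.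

Definition separated c x y := exists2 S, class c S & (x \in S) && (y \notin S).

Lemma flexible_separated c b b' a a' : flexible c b a -> flexible c b' a' -> b != b' ->
  separated c b b' \/ separated c b' b.
Proof.
move=> [S [_ cbS _ _ _]] [S' [cS' cbS' b'S' _ _]] bb'.
have [bS'|bS'] := boolP (b \in S'); first by left; exists S'; rewrite // bS'.
by right; exists (b' |: S'); rewrite // setU11 in_setU1 negb_or bb'.
Qed.

(* Along a path, [c1] and [c2] order the vertices in opposite ways. *)
Lemma same_exit_opposite c1 c2 b b' :
    iter #|T| (shift c1 c2) b \notin mu c2 @: A ->
    iter #|T| (shift c1 c2) b = iter #|T| (shift c1 c2) b' ->
  separated c1 b b' -> separated c2 b b' -> False.
Proof.
move=> exb eqbb' [S cS /andP[bS b'S]] [S' cS' /andP[bS' b'S']].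
have [[k eb]|[k eb']] := iter_same_exit (@shift_inj c1 c2) (@shift_fix c1 c2) exb eqbb'.
- by have := iter_shift_notin c1 k cS' b'S'; rewrite -eb bS'.
- by have := iter_shift_in c2 k cS bS; rewrite -eb' (negPf b'S).
Qed.

Definition exits c := ~: A :\: mu c @: A.

Lemma card_exits c : #|exits c| = #|~: A| - al.
Proof.
have [inj_mu e_mu _] := muP c.
rewrite cardsD (setIidPr _) ?card_in_imset ?cardA //.
by apply/subsetP=> _ /imsetP[a aA ->]; rewrite inE (adjA_notin aA (e_mu a aA)).
Qed.

(** The end of the path is recorded by its index among the exits; [inord] requires the successor in
    the type. *)
Definition exit_rank c1 c2 b : 'I_(#|~: A| - al).+1 :=
  inord (index (iter #|T| (shift c1 c2) b) (enum (exits c2))).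

Lemma exit_rank_inj c1 c2 b b' :
    b \notin A -> b' \notin A ->
    iter #|T| (shift c1 c2) b \notin mu c2 @: A ->
    iter #|T| (shift c1 c2) b' \notin mu c2 @: A ->
    exit_rank c1 c2 b = exit_rank c1 c2 b' ->
  iter #|T| (shift c1 c2) b = iter #|T| (shift c1 c2) b'.
Proof.
have outA x k : x \notin A -> iter k (shift c1 c2) x \notin A.
  move=> xA; elim: k => //= k; move: (iter _ _ _) => {xA}x xA.
  have [/imsetP[a aA ->]|/shift_fix->//] := boolP (x \in mu c2 @: A).
  by rewrite shift_mu //; have [_ e1 _] := muP c1; apply: (adjA_notin aA); apply: e1.
move=> bA b'A ex ex'.
have mem x : x \notin A -> x \notin mu c2 @: A -> x \in enum (exits c2).
  by move=> xA xM; rewrite mem_enum inE xM inE.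
have lt x : x \in enum (exits c2) -> index x (enum (exits c2)) < (#|~: A| - al).+1.
  by rewrite -index_mem -cardE card_exits => /ltnW.
have m1 := mem _ (outA b #|T| bA) ex; have m2 := mem _ (outA b' #|T| b'A) ex'.
move=> /(congr1 val); rewrite /= !inordK ?lt // => eqi.
by rewrite -(nth_index b m1) eqi nth_index.
Qed.

Lemma flexible_agree c1 c2 b b' a1 a2 a1' a2' :
    b \notin A -> b' \notin A ->
    flexible c1 b a1 -> flexible c2 b a2 -> a1 != a2 ->
    flexible c1 b' a1' -> flexible c2 b' a2' -> a1' != a2' ->
    exit_rank c1 c2 b = exit_rank c1 c2 b' ->
  ~ (separated c1 b b' /\ separated c2 b b') /\
  ~ (separated c1 b' b /\ separated c2 b' b).
Proof.
move=> bA b'A f1 f2 n12 f1' f2' n12' eqr.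
have ex := flexible_exit f1 f2 n12; have ex' := flexible_exit f1' f2' n12'.
have eqx := exit_rank_inj bA b'A ex ex' eqr.
split=> -[s1 s2]; first exact: same_exit_opposite ex eqx s1 s2.
exact: same_exit_opposite ex' (esym eqx) s1 s2.
Qed.

Definition inner := [set b | (b \notin A) && [forall y, e b y ==> (y \in A)]].

Definition flexible3 b (c : {set T} * {set T} * {set T}) :=
  [/\ c.1.1 \subset cover_out, c.1.2 \subset cover_out, c.2 \subset cover_out &
   exists a1 a2 a3, [/\ flexible c.1.1 b a1, flexible c.1.2 b a2, flexible c.2 b a3 &
    [/\ a1 != a2, a1 != a3 & a2 != a3]]].

(** By [min_degree] there are three edges at [b], all going to [A]; [flexible_class] gives a class
    for each. *)
Lemma inner_flexible3 b : b \in inner -> exists c, flexible3 b c.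
Proof.
rewrite inE => /andP[bA /forallP nbA].
have bC : b \notin cover_out.
  apply/imsetP=> -[p /edges_outP[_ p2A ep] eb].
  by have := nbA p.2; rewrite eb ep (negPf p2A).
have flexN a : a \in nbrs e [set b] ->
    exists2 c : {set T}, c \subset cover_out & flexible c b a.
  case/nbrsP=> _ /set1P-> ba; apply: flexible_class => //; last by rewrite e_sym.
  by have := nbA a; rewrite ba.
have /card_gt2P[a1 [a2 [a3 [[a1N a2N a3N] [n12 n23 n31]]]]] := min_degree b.
have [[c1 s1 f1] [[c2 s2 f2] [c3 s3 f3]]] := (flexN _ a1N, (flexN _ a2N, flexN _ a3N)).
exists (c1, c2, c3); split=> //; exists a1, a2, a3; split=> //; split=> //.
by rewrite eq_sym.
Qed.

(* Of three orders on [b] and [b'] two agree, so the triple of classes together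
   with the three exits determines [b]. *)
Lemma card_inner :
  #|inner| <= 2 ^ (3 * #|edges_out|) * (#|~: A| - al).+1 ^ 3.
Proof.
have [|t tP] := @fin_all_exists _ (fun=> ({set T} * {set T} * {set T})%type)
  (fun b c => b \in inner -> flexible3 b c).
  move=> b; have [/inner_flexible3[c cP]|] := boolP (b \in inner); first by exists c.
  by exists (set0, set0, set0).
pose r b := let: (c1, c2, c3) := t b in
  (exit_rank c1 c2 b, exit_rank c1 c3 b, exit_rank c2 c3 b).
pose C := powerset cover_out.
have sub : (fun b => (t b, r b)) @: inner \subset setX (setX (setX C C) C) setT.
  apply/subsetP=> _ /imsetP[b /tP[s1 s2 s3 _] ->].
  by rewrite !inE /= s1 s2 s3.
have inj : {in inner &, injective (fun b => (t b, r b))}.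
  move=> b b' bI b'I [eqt]; rewrite /r -eqt.
  have [bA b'A] : b \notin A /\ b' \notin A.
    by move: bI b'I; rewrite !inE => /andP[-> _] /andP[-> _].
  have := tP b' b'I; have := tP b bI; rewrite -eqt.
  case: (t b) => [[c1 c2] c3] /= [_ _ _ [a1 [a2 [a3 [f1 f2 f3 [n12 n13 n23]]]]]].
  case=> _ _ _ [a1' [a2' [a3' [f1' f2' f3' [n12' n13' n23']]]]] [e12 e13 e23].
  apply/eqP/negPn/negP=> nbb'.
  have [A12 A12'] := flexible_agree bA b'A f1 f2 n12 f1' f2' n12' e12.
  have [A13 A13'] := flexible_agree bA b'A f1 f3 n13 f1' f3' n13' e13.
  have [A23 A23'] := flexible_agree bA b'A f2 f3 n23 f2' f3' n23' e23.
  have := flexible_separated f1 f1' nbb'; have := flexible_separated f2 f2' nbb'.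
  have := flexible_separated f3 f3' nbb'.
  tauto.
rewrite -(card_in_imset inj); apply: leq_trans (subset_leq_card sub) _.
rewrite !cardsX card_powerset cardsT !card_prod card_ord -!expnD.
have leC : #|cover_out| <= #|edges_out| by apply: leq_imset_card.
apply: leq_mul; last by rewrite !expnS expn0 muln1 mulnA.
by rewrite leq_pexp2l //; lia.
Qed.

End Shift.

Lemma card_vertices d : #|~: A| - al <= d -> 3 <= d -> #|T| <= 2 ^ (3 * d ^ 2).
Proof.
move=> led ge3d; have [mu muP] := class_matchings.
have leI := card_inner muP; have leE := card_edges_out.
have leA : #|A| <= #|~: A|.
  have [mu0 [inj_mu e_mu _]] := tight_matching tight0.
  rewrite -(card_in_imset inj_mu); apply: subset_leq_card.
  by apply/subsetP=> _ /imsetP[a aA ->]; rewrite inE (adjA_notin aA (e_mu a aA)).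
have leB : #|~: A| <= #|inner| + 2 * #|edges_out|.
  have sB : ~: A \subset inner :|: (fst @: edges_out :|: snd @: edges_out).
    apply/subsetP=> b; rewrite inE => bA; rewrite !in_setU.
    have [bI|] := boolP (b \in inner); first by [].
    rewrite inE bA negb_forall /= => /existsP[y]; rewrite negb_imply => /andP[by_ yA].
    case: (ltngtP (enum_rank b) (enum_rank y)) => [lt|lt|/val_inj/enum_rank_inj eqby].
    - by apply/orP; left; apply/imsetP; exists (b, y); rewrite // inE bA yA by_ lt.
    - by apply/orP; right; apply/imsetP; exists (y, b); rewrite // inE bA yA e_sym by_ lt.
    - by rewrite eqby e_irr in by_.
  apply: leq_trans (subset_leq_card sB) _.
  apply: leq_trans (leq_card_setU _ _) _; rewrite leq_add2l.
  apply: leq_trans (leq_card_setU _ _) _.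
  by rewrite mul2n -addnn leq_add ?leq_imset_card.
have led2 : 3 * d <= d * d by rewrite leq_mul2r ge3d orbT.
have leE' : 2 * #|edges_out| <= d * d.+1.
  by apply: leq_trans leE _; apply: leq_mul.
have cT : #|T| <= 2 * #|~: A| by have := cardsC A; lia.
(* Equality holds at [d = 3], where the induction starts. *)
have le4 : d.+1 ^ 3 <= 2 ^ (2 * d).
  rewrite expnM -(subnK ge3d); elim: (d - 3) => // n IHn.
  rewrite addSn [leqRHS]expnS; apply: leq_trans (leq_mul (leqnn (2 ^ 2)) IHn).
  rewrite !expnS expn0; nia.
(* The 2 saved in the exponent pays for two doublings: [#|~: A|] is at most a sum of two terms of
   this size, and [#|T|] is at most twice [#|~: A|]. *)
have leI' : #|inner| <= 2 ^ (3 * d ^ 2 - 2).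
  apply: leq_trans leI _; apply: leq_trans (_ : 2 ^ (3 * #|edges_out|) * 2 ^ (2 * d) <= _).
    by rewrite leq_mul2l; apply/orP; right; apply: leq_trans le4; rewrite leq_exp2r.
  rewrite -expnD leq_pexp2l // -mulnn; move: leE'; rewrite mulnS; clear -ge3d led2.
  by move: #|_| (d * d) led2 => m s; lia.
have lesq : d * d.+1 <= 2 ^ (3 * d ^ 2 - 2).
  apply: leq_trans (ltnW (ltn_expl (d * d.+1) (ltnSn 1))) _.
  rewrite leq_pexp2l // -mulnn mulnS; clear -ge3d led2; lia.
have -> : 3 * d ^ 2 = 3 * d ^ 2 - 2 + 2 by rewrite -mulnn; clear -ge3d led2; lia.
rewrite expnD; move: (2 ^ (_ - 2)) (d * _) leI' lesq leE' => X s; lia.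
Qed.

End MaxIndependent.

(** Passing to a critical subgraph keeps the avoiding independent sets, as edges are only
    removed. *)
Lemma card_avoidable_graph (T : finType) (e0 : rel T) al d :
    symmetric e0 -> irreflexive e0 -> alpha_bound e0 al ->
    (forall S : {set T}, #|S| <= 3 ->
      exists I, [/\ indep e0 I, #|I| = al & {in S, forall x, x \notin I}]) ->
    #|T| <= 2 * al + d -> 3 <= d ->
  #|T| <= 2 ^ (3 * d ^ 2).
Proof.
move=> sym0 irr0 bnd0 avoid0 leT ge3d.
have [e [sym_e sub_e bnd_e crit_e]] := critical_subgraph sym0 bnd0.
have irr_e : irreflexive e by move=> x; apply: contraFF (irr0 x) => /sub_e.
have avoid_e (S : {set T}) : #|S| <= 3 ->
    exists I : {set T}, [/\ indep e I, #|I| = al & {in S, forall x, x \notin I}].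
  move=> /avoid0[I [/indepP iI cI dI]]; exists I; split=> //.
  by apply/indepP=> x y xI yI; apply: contra (iI x y xI yI) => /sub_e.
have [A [iA cA _]] : exists I : {set T},
    [/\ indep e I, #|I| = al & {in (set0 : {set T}), forall x, x \notin I}].
  by apply: avoid_e; rewrite cards0.
apply: (card_vertices sym_e irr_e bnd_e crit_e avoid_e iA cA) => //.
by have := cardsC A; lia.
Qed.

(** * From stability to avoiding independent sets *)

Lemma superset_card (T : finType) (S : {set T}) k :
  #|S| <= k <= #|T| -> exists2 S' : {set T}, S \subset S' & #|S'| = k.
Proof.
case/andP=> leSk lekT; exists (S :|: [set x in take (k - #|S|) (enum (~: S))]).
  exact: subsetUl.
rewrite cardsU (_ : S :&: _ = set0).
  rewrite cards0 subn0 cardsE (card_uniqP _) ?take_uniq ?enum_uniq //.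
  rewrite size_takel ?subnKC // -cardE; have := cardsC S; lia.
apply/setP=> x; rewrite !inE; apply/andP=> -[xS /mem_take].
by rewrite mem_enum inE xS.
Qed.

Section DeleteVertices.
Variables (G : sgraph) (S : {set G}).

Lemma alpha_max : alpha_bound (@adj G) (alpha G).
Proof. by move=> A iA; apply: leq_bigmax_cond. Qed.

Lemma alpha_attained : exists2 A : {set G}, independent A & #|A| = alpha G.
Proof.
have [|A iA eA] := @eq_bigmax_cond _ (@independent G) (fun A : {set G} => #|A|).
  apply/card_gt0P; exists set0; rewrite unfold_in.
  by apply/forall_inP=> x; rewrite inE.
by exists A; rewrite // -eA.
Qed.

Lemma independent_del (A : {set del S}) : independent A -> independent (val @: A).
Proof.
move/indepP=> iA; apply/indepP=> _ _ /imsetP[x xA ->] /imsetP[y yA ->].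
exact: (iA x y xA yA).
Qed.

Lemma card_val_del (A : {set del S}) : #|val @: A| = #|A|.
Proof. by apply: card_imset; apply: val_inj. Qed.

End DeleteVertices.

(** Stability concerns sets of exactly [k] vertices, so [S] is first enlarged to that size. *)
Lemma stable_avoid (G : sgraph) k (S : {set G}) :
    stable k 0 G -> #|S| <= k <= #|G| ->
  exists I : {set G}, [/\ independent I, #|I| = alpha G & {in S, forall x, x \notin I}].
Proof.
move=> st /superset_card[S' sSS' /st]; rewrite subn0 => le_alpha.
have [A iA cA] := alpha_attained (del S').
exists (val @: A); split; first exact: independent_del.
  have := alpha_max (independent_del iA).
  by move: le_alpha; rewrite card_val_del -cA => h1 h2; apply/eqP; rewrite eqn_leq h1 h2.
move=> x /(subsetP sSS') xS'; apply/imsetP=> -[y _ ex].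
by have := valP y; rewrite /= -ex xS'.
Qed.

Theorem theorem1p6 (k q : nat) (hk : 3 <= k) (G : sgraph)
    (hG : tight_stable q k 0 G) :
  #|G| <= (k - 3) + 2 ^ (3 * (2 * q + 3) ^ 2).
Proof.
case: hG => st eq_alpha.
have [ltGk|lekG] := ltnP #|G| k.
  have : 2 ^ 2 <= 2 ^ (3 * (2 * q + 3) ^ 2) by rewrite leq_pexp2l // -mulnn; lia.
  by move: (2 ^ (3 * _)) => X; lia.
(* Any three further vertices together with [S0] number at most [k]. *)
have [|S0 _ cS0] := @superset_card G set0 (k - 3); first by rewrite cards0; lia.
have cdel : #|del S0| = #|G| - (k - 3).
  rewrite -cS0; have := cardsC S0; suff -> : #|~: S0| = #|del S0| by lia.
  by rewrite card_sig; apply: eq_card => x; rewrite !inE.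
suff : #|del S0| <= 2 ^ (3 * (2 * q + 3) ^ 2) by rewrite cdel leq_subLR.
apply: (@card_avoidable_graph (del S0) (@del_adj G S0) (alpha G)).
- exact: del_adj_sym.
- exact: del_adj_irrefl.
- by move=> A /independent_del iA; rewrite -card_val_del; apply: alpha_max.
- move=> S leS3; have [|I [iI cI dI]] := stable_avoid (S := S0 :|: val @: S) st.
    rewrite lekG andbT; apply: leq_trans (leq_card_setU _ _) _.
    by rewrite cS0 card_val_del; lia.
  have valI : val @: [set u : del S0 | val u \in I] = I.
    apply/setP=> x; apply/imsetP/idP=> [[u]|xI]; first by rewrite inE => uI ->.
    have xS0 : x \notin S0 by apply: contraL xI => xS0; rewrite dI // inE xS0.
    by exists (Sub x xS0); rewrite ?inE SubK.
  exists [set u | val u \in I]; split.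
  + move/indepP: iI => iI; apply/indepP=> u v; rewrite !inE => uI vI.
    exact: iI.
  + by rewrite -card_val_del valI.
  + move=> u uS; rewrite inE dI //; apply/setUP; right; exact: imset_f.
(* Here [d = 2 * q + 3]: the floor gives [#|G| - k + 1 <= 2 * (alpha G + q) + 1], and 2 is added on
   both sides. *)
- rewrite cdel; lia.
- by lia.
Qed.
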